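(* Let $\mathcal{A}=\{c<d\}$ be an alphabet consisting of two positive integers $c<d$, and let $w\in\mathcal{A}^\omega$ be an infinite smooth word. Then $w$ is an infinite Lyndon word if and only if one of the following holds: (i) $c$ and $d$ are both even and $w=m_{\{c<d\}}$; (ii) $c=1$, $d$ is odd, and $w\in\{m_{\{1<d\}},\ \Delta^{-1}_1(m_{\{1<d\}})\}$. (Equivalently: the only infinite smooth words over a 2-letter alphabet of positive integers that are infinite Lyndon words are $m_{\{2a<2b\}}$, $m_{\{1<2b+1\}}$ and $\Delta^{-1}_1(m_{\{1<2b+1\}})$ for positive integers $a<b$, resp. $b\ge 1$.)
   Context: Alphabets are sets of positive integers ordered by the usual order; words over them are compared with the lexicographic order (a proper prefix is smaller). Run-length encoding: every finite or infinite word $w$ over $\{c,d\}$ is uniquely a product of maximal blocks $\alpha_0^{i_0}\alpha_1^{i_1}\alpha_2^{i_2}\cdots$ with $\alpha_{k+1}\neq\alpha_k$, $i_k\ge1$; then $\Delta(w)=i_0i_1i_2\cdots$, a word over the positive integers. An infinite word $w\in\mathcal{A}^\omega$ is an infinite smooth word if $\Delta^k(w)\in\mathcal{A}^\omega$ for every $k\ge0$. $m_{\mathcal{A}}$ denotes the minimal infinite smooth word over $\mathcal{A}$ with respect to the lexicographic order. For $\alpha\in\{c,d\}$ with complement $\overline{\alpha}$ (the other letter) and a word $u$ over the positive integers, $\Delta^{-1}_\alpha(u)=\alpha^{u[0]}\overline{\alpha}^{u[1]}\alpha^{u[2]}\overline{\alpha}^{u[3]}\cdots$. An infinite Lyndon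 word is an infinite word strictly smaller (lexicographically) than each of its proper suffixes. *)

(* Defs.v *)
From mathcomp Require Import all_boot.
From mathcomp Require Import boolp.
Set Implicit Arguments.
Unset Strict Implicit.
Unset Printing Implicit Defensive.

Definition iword := nat -> nat.

Definition over (c d : nat) (w : iword) : Prop :=
  forall n, w n = c \/ w n = d.

Definition isuffix (k : nat) (w : iword) : iword := fun n => w (k + n).

(* No prefix clause is needed: both words are infinite. *)
Definition lex_lt (u v : iword) : Prop :=
  exists2 n, (forall i, i < n -> u i = v i) & u n < v n.

Definition lex_le (u v : iword) : Prop := u = v \/ lex_lt u v.

(* The least l with w (s + l) <> w s, i.e. the length of the run starting at
   position s, and 0 if that run is infinite. *)
Definition run_length (w : iword) (s : nat) : nat :=
  match pselect (exists l, w (s + l) != w s) with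
  | left run_ends => ex_minn run_ends
  | right _ => 0
  end.

Fixpoint run_start (w : iword) (k : nat) : nat :=
  if k is k'.+1 then run_start w k' + run_length w (run_start w k') else 0.

(* When w is eventually constant, its run-length encoding is not an infinite
   word of positive integers; Delta w is then 0 from the infinite run onwards,
   so it is not a word over any alphabet of positive integers. *)
Definition Delta (w : iword) : iword := fun k => run_length w (run_start w k).

Definition smooth (c d : nat) (w : iword) : Prop :=
  forall k, over c d (iter k Delta w).

(* "m is the word m_{c<d}": the lexicographic order being total and
   antisymmetric, at most one m satisfies this. *)
Definition minimal_smooth (c d : nat) (m : iword) : Prop :=
  smooth c d m /\ forall v, smooth c d v -> lex_le m v.

Definition other_letter (c d a : nat) : nat := if a == c then d else c.

(* a^{u 0} b^{u 1} a^{u 2} b^{u 3} ..., where {a, b} = {c, d}. For u positive,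
   the first n.+1 blocks have total length at least n.+1, so they determine the
   letter at position n. *)
Definition Delta_inv (c d a : nat) (u : iword) : iword := fun n =>
  nth 0 (flatten [seq nseq (u i) (if odd i then other_letter c d a else a)
                 | i <- iota 0 n.+1]) n.

Definition infinite_Lyndon (w : iword) : Prop :=
  forall k, 0 < k -> lex_lt w (isuffix k w).

(* Main.v *)
(* Write Delta for the run-length encoding.  Two words with the same first letter
   compare as their encodings do, except that the order on the encodings is
   twisted: in the lexicographic case a longer c-run makes a word smaller and a
   longer d-run makes it larger.  For letters of equal parity the twisted orders stay within
   two orders, the lexicographic one and the alternating one (at even positions the
   larger letter is the smaller one): lexicographic order passes to alternating
   order, and alternating order passes to alternating order for even letters and
   back to lexicographic order for odd ones.  Hence the minimal smooth word is
   characterised by greedy initial letters of its iterated encodings, and the Lyndon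
   condition can be pushed through Delta level by level, which forces these letters
   (for odd letters possibly only from Delta(w) on, and then c = 1).

   If c and d have different parities, the Lyndon condition on w forces c = 1 and
   constrains the word x = Delta^3(w) through three parities read off x.  Smoothness
   makes this constraint violated within a bounded prefix: a finite search over the
   initial letters of x, Delta(x), Delta^2(x), ... finds a violation in every branch,
   where d matters only modulo 16 once d >= 16. *)
Require Import Defs.
From mathcomp Require Import all_boot.
From mathcomp Require Import boolp zify.
Set Implicit Arguments.
Unset Strict Implicit.
Unset Printing Implicit Defensive.

(** * Run-length encodings *)

Definition positive (u : iword) : Prop := forall n, 0 < u n.

(** When [u] is the run-length encoding of a word, [psum u n] is the position where run [n]
    starts. *)
Fixpoint psum (u : iword) (n : nat) : nat :=
  if n is n'.+1 then psum u n' + u n' else 0.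

Lemma run_lengthE w s l : 0 < l -> (forall i, i < l -> w (s + i) = w s) ->
  w (s + l) != w s -> run_length w s = l.
Proof.
move=> l_gt0 same diff; rewrite /run_length; case: pselect => [ex|[]]; last by exists l.
case: ex_minnP => m m_diff m_min; apply/eqP; rewrite eqn_leq m_min //= leqNgt.
by apply/negP => /same E; rewrite E eqxx in m_diff.
Qed.

Lemma run_lengthP w s : 0 < run_length w s ->
  (forall i, i < run_length w s -> w (s + i) = w s) /\
  w (s + run_length w s) != w s.
Proof.
rewrite /run_length; case: pselect => [ex|//].
case: ex_minnP => m m_diff m_min _; split=> // i lt_im; apply/eqP/negPn/negP.
by move/m_min; rewrite leqNgt lt_im.
Qed.

Lemma run_startE w k : run_start w k = psum (Delta w) k.
Proof. by elim: k => //= k <-. Qed.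

Lemma psum_cover u p : positive u -> exists k j, j < u k /\ p = psum u k + j.
Proof.
move=> u_gt0; elim: p => [|p [k [j [lt_j ->]]]]; first by exists 0, 0; split.
have [lt_j1|le_uj] := ltnP j.+1 (u k); first by exists k, j.+1; split=> //; lia.
by exists k.+1, 0; split=> //=; lia.
Qed.

Lemma leq_psum u k : positive u -> k <= psum u k.
Proof. by move=> u_gt0; elim: k => //= k IH; have := u_gt0 k; lia. Qed.

Lemma psum_eq u v n : (forall i, i < n -> u i = v i) -> psum u n = psum v n.
Proof.
elim: n => //= n IH e; rewrite IH ?e // => i lt_in.
by apply: e; apply: ltnW.
Qed.

Lemma psumD u k i : psum u (k + i) = psum u k + psum (isuffix k u) i.
Proof. by elim: i => [|i IH]; rewrite ?addn0 // addnS /= IH addnA. Qed.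

Lemma isuffix_gt0 k u : positive u -> positive (isuffix k u).
Proof. by move=> u_gt0 n; apply: u_gt0. Qed.

Section Alphabet.

Variables c d : nat.

Definition letter (b : bool) : nat := if b then d else c.

(** The run lengths are arbitrary here: a suffix that begins inside a run has a first length that
    may lie outside the alphabet. *)
Definition coded (b : bool) (u w : iword) : Prop :=
  forall k j, j < u k -> w (psum u k + j) = letter (b (+) odd k).

Lemma coded0 b u w k : positive u -> coded b u w ->
  w (psum u k) = letter (b (+) odd k).
Proof. by move=> u_gt0 cod; rewrite -(addn0 (psum u k)); apply: cod. Qed.

Lemma coded_eq b u w w' : positive u -> coded b u w -> coded b u w' -> w = w'.
Proof.
move=> u_gt0 cod cod'; apply/funext => p.
have [k [j [lt_j ->]]] := psum_cover p u_gt0.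
by rewrite cod ?cod'.
Qed.

Lemma coded_suffix b u w k : coded b u w ->
  coded (b (+) odd k) (isuffix k u) (isuffix (psum u k) w).
Proof.
by move=> cod i j lt_j; rewrite /isuffix addnA -psumD cod // oddD addbA.
Qed.

Definition scons (a : nat) (u : iword) : iword := fun n => if n is n'.+1 then u n' else a.

Lemma scons_gt0 a u : 0 < a -> positive u -> positive (scons a u).
Proof. by move=> a_gt0 u_gt0 []. Qed.

Lemma psum_scons a u n : psum (scons a u) n.+1 = a + psum u n.
Proof. by elim: n => [|n /= ->]; rewrite /= ?addn0 ?add0n // addnA. Qed.

Lemma coded_mid b u w k r q : coded b u w -> r <= u k -> q + r = psum u k.+1 ->
  coded (b (+) odd k) (scons r (isuffix k.+1 u)) (isuffix q w).
Proof.
move=> cod le_r /= Eq [|i] j lt_j.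
  by rewrite /= in lt_j *; rewrite /isuffix (_ : q + _ = psum u k + (u k - r + j)) ?cod ?addbF; lia.
rewrite /isuffix psum_scons.
rewrite (_ : q + _ = psum u (k.+1 + i) + j) ?cod //; last first.
  by rewrite psumD /= /isuffix; lia.
by congr letter; rewrite addSn /= oddD; case: (b) (odd k) (odd i) => [] [] [].
Qed.

(** Where the shorter of the first two differing runs ends, one word has changed its letter and the
    other has not. *)
Lemma cmp_run b u w u' w' n : positive u -> coded b u w -> coded b u' w' ->
    (forall i, i < n -> u i = u' i) -> u n < u' n ->
  [/\ forall i, i < psum u n.+1 -> w i = w' i,
      w (psum u n.+1) = letter (b (+) odd n.+1) &
      w' (psum u n.+1) = letter (b (+) odd n)].
Proof.
move=> u_gt0 cod cod' same lt_n; split; last 2 first.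
- by rewrite (coded0 _ u_gt0 cod).
- by rewrite /= (psum_eq same) cod'.
move=> i lt_i; have [k [j [lt_j Ei]]] := psum_cover i u_gt0.
have le_kn: k <= n.
  rewrite leqNgt; apply/negP => lt_nk.
  have : psum u n.+1 <= psum u k by rewrite -(subnKC lt_nk) psumD leq_addr.
  by lia.
rewrite {}Ei cod // (@psum_eq u u' k) ?cod' //; last first.
  by move=> i' lt_i'; apply: same; lia.
move: le_kn; rewrite leq_eqVlt => /orP[/eqP Ek|/same <- //].
by rewrite Ek in lt_j *; apply: ltn_trans lt_n.
Qed.

Hypotheses (c_gt0 : 0 < c) (lt_cd : c < d).

Lemma letter_gt0 b : 0 < letter b.
Proof. by case: b; rewrite /letter; lia. Qed.

Lemma letter_inj b b' : letter b = letter b' -> b = b'.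
Proof. by case: b b' => [] []; rewrite /letter //; lia. Qed.

Lemma coded_Delta b u w : positive u -> coded b u w -> Delta w = u.
Proof.
move=> u_gt0 cod.
have run k : run_length w (psum u k) = u k.
  apply: run_lengthE => // [i lt_i|]; first by rewrite cod // (coded0 _ u_gt0 cod).
  rewrite (coded0 k.+1 u_gt0 cod) (coded0 k u_gt0 cod).
  by apply/eqP => /letter_inj /=; case: (b) (odd k) => [] [].
apply/funext => k; rewrite /Delta.
suff -> : run_start w k = psum u k by [].
by elim: k => //= k ->; rewrite run.
Qed.

Lemma over_letter w n : Defs.over c d w -> w n = letter (w n == d).
Proof. by move=> /(_ n)[] ->; rewrite ?eqxx // ltn_eqF. Qed.

Lemma over_gt0 w : Defs.over c d w -> positive w.
Proof. by move=> ov n; rewrite (over_letter n ov) letter_gt0. Qed.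

Lemma over_coded w : Defs.over c d w -> positive (Delta w) -> coded (w 0 == d) (Delta w) w.
Proof.
move=> ov D_gt0.
have DE k : Delta w k = run_length w (psum (Delta w) k) by rewrite -run_startE.
have start k : w (psum (Delta w) k) = letter ((w 0 == d) (+) odd k).
  elim: k => [|k IH]; first by rewrite addbF; apply: over_letter.
  have := D_gt0 k; rewrite DE => /run_lengthP[_].
  rewrite -DE -/(psum _ k.+1) IH.
  rewrite (over_letter (psum _ k.+1) ov) oddS.
  by case: (w (psum _ k.+1) == d) (odd k) (w 0 == d) => [] [] []; rewrite /= ?eqxx.
move=> k j lt_j; rewrite -start.
by have := D_gt0 k; rewrite DE => /run_lengthP[same _]; apply: same; rewrite -DE.
Qed.

Lemma smooth_over w : smooth c d w -> Defs.over c d w.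
Proof. by move/(_ 0). Qed.

Lemma smooth_Delta w : smooth c d w -> smooth c d (Delta w).
Proof. by move=> sm k; rewrite -iterSr. Qed.

Lemma smooth_cons w : Defs.over c d w -> smooth c d (Delta w) -> smooth c d w.
Proof. by move=> ov sm [//|k]; rewrite iterSr. Qed.

Lemma smooth_gt0 w : smooth c d w -> positive w.
Proof. by move/smooth_over/over_gt0. Qed.

Lemma smooth_coded w b : smooth c d w -> w 0 = letter b -> coded b (Delta w) w.
Proof.
move=> sm w0; suff -> : b = (w 0 == d).
  by apply: over_coded; [apply: smooth_over|apply/smooth_gt0/smooth_Delta].
by rewrite w0; case: (b); rewrite /= ?eqxx // ltn_eqF.
Qed.

Lemma smooth_occurs w b N : smooth c d w -> exists2 n, N <= n & w n = letter b.
Proof.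
move=> sm; have D_gt0 := smooth_gt0 (smooth_Delta sm).
have cod := smooth_coded sm (over_letter 0 (smooth_over sm)).
pose k := if ((w 0 == d) (+) odd N) == b then N else N.+1.
exists (psum (Delta w) k).
  by apply: (leq_trans _ (leq_psum _ D_gt0)); rewrite /k; case: ifP.
rewrite (coded0 _ D_gt0 cod); congr letter; rewrite /k.
by case: ifP => [/eqP//|/=]; case: (b) (w 0 == d) (odd N) => [] [] [].
Qed.

Lemma coded_over b u w : positive u -> coded b u w -> Defs.over c d w.
Proof.
move=> u_gt0 cod p; have [k [j [lt_j ->]]] := psum_cover p u_gt0.
by rewrite cod //; case: (_ (+) _); [right|left].
Qed.

Lemma Delta_inv_coded b u : positive u -> coded b u (Delta_inv c d (letter b) u).
Proof.
move=> u_gt0 k j lt_j.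
pose t i := nseq (u i) (if odd i then other_letter c d (letter b) else letter b).
have sz n : size (flatten [seq t i | i <- iota 0 n]) = psum u n.
  elim: n => [//|n IH].
  by rewrite -addn1 iotaD map_cat flatten_cat size_cat IH /= addn1 cats0 size_nseq.
rewrite /Delta_inv -/t; set p := psum u k + j.
have le_kp : k <= p by rewrite /p; have := leq_psum k u_gt0; lia.
have -> : p.+1 = k + (p - k).+1 by lia.
rewrite iotaD map_cat flatten_cat nth_cat sz ltnNge leq_addr /= add0n.
have -> : p - psum u k = j by rewrite /p addKn.
rewrite nth_cat size_nseq lt_j nth_nseq lt_j.
rewrite /other_letter /letter.
by case: (odd k); case: (b); rewrite /= ?eqxx // gtn_eqF.
Qed.

End Alphabet.

(** * Lexicographic and alternating orders *)

(** [false] selects the lexicographic order and [true] the alternating one, so that [letter c d o]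
    is the favourable first letter for the order [o]. *)
Definition precedes (o : bool) (u v : iword) : Prop :=
  exists2 n, (forall i, i < n -> u i = v i) &
    if o && ~~ odd n then v n < u n else u n < v n.

Lemma first_diff (u v : iword) : u <> v ->
  exists2 n, (forall i, i < n -> u i = v i) & u n != v n.
Proof.
move=> ne_uv; have ex : exists n, u n != v n.
  apply: contrapT => no; apply: ne_uv; apply/funext => n.
  by apply/eqP/negPn/negP => ne; apply: no; exists n.
case: (ex_minnP ex) => n ne_n n_min; exists n => // i lt_in.
by apply/eqP/negPn/negP => /n_min; rewrite leqNgt lt_in.
Qed.

Lemma precedes_at o u v n : precedes o u v -> (forall i, i < n -> u i = v i) ->
  u n != v n -> if o && ~~ odd n then v n < u n else u n < v n.
Proof.
case=> m same_m lt_m same_n ne_n.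
have [lt_mn|lt_nm|<-//] := ltngtP m n.
- by move: lt_m; rewrite same_n // ltnn if_same.
- by rewrite same_m // eqxx in ne_n.
Qed.

Lemma precedes_le0 o u v : precedes o u v -> if o then v 0 <= u 0 else u 0 <= v 0.
Proof.
move=> lt_uv; have [->|ne0] := eqVneq (u 0) (v 0); first by rewrite leqnn if_same.
have none i : i < 0 -> u i = v i by [].
have := precedes_at lt_uv none ne0.
by rewrite andbT; case: (o) => /ltnW.
Qed.

Lemma precedes_total o u v : [\/ u = v, precedes o u v | precedes o v u].
Proof.
have [->|/first_diff[n same ne_n]] := pselect (u = v); first by constructor 1.
have same' i : i < n -> v i = u i by move/same.
case/boolP: (o && ~~ odd n) => on; have := ne_n; rewrite neq_ltn => /orP[] lt_n.
- by constructor 3; exists n; rewrite ?on.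
- by constructor 2; exists n; rewrite ?on.
- by constructor 2; exists n; rewrite ?(negPf on).
- by constructor 3; exists n; rewrite ?(negPf on).
Qed.

Lemma precedes_neq o u : ~ precedes o u u.
Proof. by case=> n _; rewrite ltnn if_same. Qed.

Lemma precedes_asym o u v : precedes o u v -> ~ precedes o v u.
Proof.
case=> n same lt_uv lt_vu.
have ne_n : v n != u n by move: lt_uv; case: ifP => _; lia.
have := precedes_at lt_vu (fun i lt_in => esym (same i lt_in)) ne_n.
by move: lt_uv; case: ifP => _; lia.
Qed.

Section Transfer.

Variables c d : nat.
Hypotheses (c_gt0 : 0 < c) (lt_cd : c < d).

Notation L := (letter c d).

Lemma odd_psum u k : odd d = odd c -> Defs.over c d u ->
  odd (psum u k) = odd c && odd k.
Proof.
move=> odd_cd ov; elim: k => [|k IH]; first by rewrite andbF.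
have -> : odd (psum u k.+1) = odd (psum u k) (+) odd (u k) by rewrite /= oddD.
by rewrite IH; case: (ov k) => ->; rewrite ?odd_cd /=; case: (odd c) (odd k) => [] [].
Qed.

(* The order on run-length encodings which corresponds to [precedes o] on the
   words with first letter [letter c d o]; it is alternating for [o = false],
   and for [o = true] it depends on the common parity of [c] and [d]. *)
Definition next_order (o : bool) : bool := ~~ o || ~~ odd c.

(** The words first differ where the shorter of the two runs of index [n] ends. The parity of [n]
    tells which letter this run has, and in the alternating case that position is odd exactly when
    [odd c && odd n.+1]; combining the two signs gives [next_order]. *)
Lemma precedes_coded (o : bool) u u' w w' : (o -> odd d = odd c) ->
  Defs.over c d u -> Defs.over c d u' ->
  coded c d o u w -> coded c d o u' w' -> precedes (next_order o) u u' -> precedes o w w'.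
Proof.
move=> odd_cd ov ov' cod cod' [n same lt_n].
have u_gt0 := over_gt0 c_gt0 lt_cd ov; have u'_gt0 := over_gt0 c_gt0 lt_cd ov'.
have odd_p v k : Defs.over c d v -> o && ~~ odd (psum v k) = o && ~~ (odd c && odd k).
  by move=> ov_v; case: (o) odd_cd => //= odd_cd; rewrite odd_psum ?odd_cd.
have [lt_uu'|lt_u'u|eq_n] := ltngtP (u n) (u' n); last first.
- by move: lt_n; rewrite eq_n ltnn if_same.
- have same' i : i < n -> u' i = u i by move/same.
  have [agree w'E wE] := cmp_run u'_gt0 cod' cod same' lt_u'u.
  exists (psum u' n.+1); first by move=> i /agree.
  rewrite w'E wE odd_p // /letter /=.
  move: lt_n; rewrite /next_order lt_u'u (ltnNge (u n)) (ltnW lt_u'u) /=.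
  by case: (o) (odd c) (odd n) => [] [] [].
- have [agree wE w'E] := cmp_run u_gt0 cod cod' same lt_uu'.
  exists (psum u n.+1) => //.
  rewrite w'E wE odd_p // /letter /=.
  move: lt_n; rewrite /next_order lt_uu' (ltnNge (u' n)) (ltnW lt_uu') /=.
  by case: (o) (odd c) (odd n) => [] [] [].
Qed.

Lemma coded_precedes (o : bool) u u' w w' : (o -> odd d = odd c) ->
  Defs.over c d u -> Defs.over c d u' ->
  coded c d o u w -> coded c d o u' w' -> precedes o w w' -> precedes (next_order o) u u'.
Proof.
move=> odd_cd ov ov' cod cod' lt_w.
have u_gt0 := over_gt0 c_gt0 lt_cd ov.
case: (precedes_total (next_order o) u u') => // [Eu|lt_u'].
- rewrite -Eu in cod'; rewrite (coded_eq u_gt0 cod' cod) in lt_w.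
  by case: (precedes_neq lt_w).
- by case: (precedes_asym lt_w (precedes_coded odd_cd ov' ov cod' cod lt_u')).
Qed.

Lemma letterNE o a : a = c \/ a = d -> a <> L o -> a = L (~~ o).
Proof. by case: o => -[]. Qed.

Lemma precedes_head o u v : u 0 = L o -> v 0 = L (~~ o) -> precedes o u v.
Proof. by move=> u0 v0; exists 0; rewrite // u0 v0 andbT; case: (o). Qed.

Definition greedy (o : bool) (w : iword) : Prop :=
  forall k, iter k Delta w 0 = L (iter k next_order o).

Lemma greedy0 o w : greedy o w -> w 0 = L o.
Proof. by move/(_ 0). Qed.

Lemma greedy_Delta o w : greedy o w -> greedy (next_order o) (Delta w).
Proof. by move=> gr k; rewrite -!iterSr. Qed.

Lemma greedyS o w : w 0 = L o -> greedy (next_order o) (Delta w) -> greedy o w.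
Proof. by move=> w0 gr [//|k]; rewrite !iterSr. Qed.

Section SameParity.

Hypothesis odd_cd : odd d = odd c.

(** Induction on the position of the first difference: words with the same first letter agree at
    least as far as their encodings do, so the encodings differ strictly earlier. *)
Lemma greedy_precedes_at n o w v : smooth c d w -> smooth c d v -> greedy o w ->
  (forall i, i < n -> w i = v i) -> w n != v n -> precedes o w v.
Proof.
elim/ltn_ind: n o w v => n IH o w v sm_w sm_v gr same ne_n.
have w0 := greedy0 gr.
have [v0|/(letterNE (smooth_over sm_v 0)) v0] := pselect (v 0 = L o); last first.
  exact: precedes_head.
have [smD smD'] := (smooth_Delta sm_w, smooth_Delta sm_v).
have [D_gt0 D'_gt0] := (smooth_gt0 c_gt0 lt_cd smD, smooth_gt0 c_gt0 lt_cd smD').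
have cod := smooth_coded c_gt0 lt_cd sm_w w0.
have cod' := smooth_coded c_gt0 lt_cd sm_v v0.
have [m same_m ne_m] : exists2 m, (forall i, i < m -> Delta w i = Delta v i) &
    Delta w m != Delta v m.
  apply: first_diff => ED; rewrite ED in cod.
  by rewrite (coded_eq D'_gt0 cod cod') eqxx in ne_n.
have lt_mn : m < n.
  rewrite ltnNge; apply/negP => le_nm.
  have := ne_m; rewrite neq_ltn => /orP[] lt_m.
    have [agree _ _] := cmp_run D_gt0 cod cod' same_m lt_m.
    rewrite agree ?eqxx // in ne_n.
    by have := leq_psum m.+1 D_gt0; lia.
  have same_m' i : i < m -> Delta v i = Delta w i by move/same_m.
  have [agree _ _] := cmp_run D'_gt0 cod' cod same_m' lt_m.
  rewrite agree ?eqxx // in ne_n.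
  by have := leq_psum m.+1 D'_gt0; lia.
have := IH m lt_mn (next_order o) _ _ smD smD' (greedy_Delta gr) same_m ne_m.
by apply: precedes_coded cod cod' => //; apply: smooth_over.
Qed.

Lemma greedy_precedes o w v : smooth c d w -> smooth c d v -> greedy o w ->
  w = v \/ precedes o w v.
Proof.
move=> sm_w sm_v gr; case: (pselect (w = v)) => [|ne]; first by left.
by have [n same ne_n] := first_diff ne; right; apply: greedy_precedes_at same ne_n.
Qed.

Lemma smooth_Delta_inv o v : smooth c d v ->
  [/\ smooth c d (Delta_inv c d (L o) v), Delta (Delta_inv c d (L o) v) = v &
      coded c d o v (Delta_inv c d (L o) v)].
Proof.
move=> sm; have v_gt0 := smooth_gt0 c_gt0 lt_cd sm.
have cod := Delta_inv_coded c_gt0 lt_cd o v_gt0.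
have ED := coded_Delta c_gt0 lt_cd v_gt0 cod.
split=> //; apply: smooth_cons; last by rewrite ED.
exact: coded_over v_gt0 cod.
Qed.

(* Replacing the first non-greedy letter of the sequence of initial letters
   gives a smaller smooth word. *)
Lemma not_greedy_smaller k o w : smooth c d w ->
  iter k Delta w 0 <> L (iter k next_order o) -> exists2 v, smooth c d v & precedes o v w.
Proof.
elim: k o w => [|k IH] o w sm.
  move=> /(letterNE (smooth_over sm 0)) w0.
  have [smv _ cod] := smooth_Delta_inv o (smooth_Delta sm).
  exists (Delta_inv c d (L o) (Delta w)) => //; apply: precedes_head => //.
  by have := cod 0 0; rewrite addbF; apply; apply: (smooth_gt0 c_gt0 lt_cd (smooth_Delta sm)).
rewrite !iterSr => /(IH _ _ (smooth_Delta sm))[v' smv' lt_v'].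
have [smv _ cod] := smooth_Delta_inv o smv'.
exists (Delta_inv c d (L o) v') => //.
have [w0|/(letterNE (smooth_over sm 0)) w0] := pselect (w 0 = L o); last first.
  apply: precedes_head => //.
  by have := cod 0 0; rewrite addbF; apply; apply: (smooth_gt0 c_gt0 lt_cd smv').
apply: (precedes_coded (fun=> odd_cd) _ _ cod (smooth_coded c_gt0 lt_cd sm w0) lt_v').
  exact: smooth_over.
exact/smooth_over/smooth_Delta.
Qed.

Lemma minimal_greedyP w : smooth c d w ->
  minimal_smooth c d w <-> greedy false w.
Proof.
move=> sm; split=> [[_ w_min] k|gr].
  apply: contrapT => /(not_greedy_smaller sm)[v smv lt_vw].
  have [Ew|lt_wv] := w_min v smv; first by rewrite Ew in lt_vw; case: (precedes_neq lt_vw).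
  exact: precedes_asym lt_vw lt_wv.
by split=> // v smv; apply: (greedy_precedes (o := false)).
Qed.

End SameParity.

End Transfer.

(** * Even letters *)

Lemma ltn_psum u k : positive u -> 1 < u 0 -> 0 < k -> k < psum u k.
Proof.
move=> u_gt0 u0; case: k => // k _.
have -> : psum u k.+1 = u 0 + psum (isuffix 1 u) k by rewrite -add1n psumD /= add0n.
by have := leq_psum k (isuffix_gt0 1 u_gt0); lia.
Qed.

Lemma even_halfE n : ~~ odd n -> n = n./2.*2.
Proof. lia. Qed.

(** The trace of the Lyndon property on the encoding: the runs of even index are those that begin
    with the first letter of the word, and for equal first letters lexicographic order becomes
    alternating order. *)
Definition even_minimal (u : iword) : Prop :=
  forall k, 0 < k -> precedes true u (isuffix k.*2 u).

Section Lyndon.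

Variables c d : nat.
Hypotheses (c_gt0 : 0 < c) (lt_cd : c < d).

Notation L := (letter c d).

Lemma over_isuffix k u : Defs.over c d u -> Defs.over c d (isuffix k u).
Proof. by move=> ov n; apply: ov. Qed.

Lemma isuffix0 k u : isuffix k u 0 = u k.
Proof. by rewrite /isuffix addn0. Qed.

Lemma Lyndon_Delta w : smooth c d w -> infinite_Lyndon w ->
  w 0 = c /\ even_minimal (Delta w).
Proof.
move=> sm lyn; have smD := smooth_Delta sm.
have D_gt0 := smooth_gt0 c_gt0 lt_cd smD.
have w0 : w 0 = c.
  have [//|w0] := smooth_over sm 0.
  have cod := smooth_coded c_gt0 lt_cd sm (b := true) w0.
  have p_gt0 : 0 < psum (Delta w) 1 by rewrite /= add0n.
  have := @precedes_le0 false _ _ (lyn _ p_gt0).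
  by rewrite isuffix0 (coded0 1 D_gt0 cod) w0 /letter /=; lia.
split=> // k k_gt0.
have cod := smooth_coded c_gt0 lt_cd sm (b := false) w0.
have cod' := coded_suffix (k := k.*2) cod; rewrite odd_double in cod'.
apply: (coded_precedes c_gt0 lt_cd _ _ _ cod cod' (lyn _ _)) => //.
- exact: smooth_over.
- exact/over_isuffix/smooth_over.
- by have := leq_psum k.*2 D_gt0; lia.
Qed.

Lemma even_minimal_head u k : Defs.over c d u -> even_minimal u -> u 0 = c ->
  u k.*2 = c.
Proof.
move=> ov Q u0; have [->|k_gt0] := posnP k; first by [].
case: (ov k.*2) => // uk.
by have := precedes_le0 (Q _ k_gt0); rewrite isuffix0 uk u0; lia.
Qed.

(** Runs of odd index consist of [d]; one of length two would cover an even position. As run lengths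
    are letters, 1 is a letter. *)
Lemma even_const_runs u : smooth c d u -> (forall k, u k.*2 = c) ->
  c = 1 /\ forall k, odd k -> Delta u k = 1.
Proof.
move=> sm u_even.
have u0 := u_even 0; rewrite double0 in u0.
have cod := smooth_coded c_gt0 lt_cd sm (b := false) u0.
have ovD := smooth_over (smooth_Delta sm).
have D_gt0 := over_gt0 c_gt0 lt_cd ovD.
have run k : odd k -> Delta u k = 1.
  move=> odd_k; apply/eqP; rewrite eqn_leq D_gt0 andbT leqNgt; apply/negP => D_gt1.
  set s := psum (Delta u) k.
  have us i : i < 2 -> u (s + i) = d.
    by move=> lt_i; rewrite cod ?odd_k //; apply: leq_trans D_gt1.
  have [i lt_i Ei] : exists2 i, i < 2 & s + i = (uphalf s).*2.
    by exists (odd s); lia.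
  by have := us i lt_i; rewrite Ei u_even; lia.
by split=> //; case: (ovD 1) => //; rewrite run //; lia.
Qed.

(** The first run of [w] has the maximal length [d]. A suffix starting with the wrong letter, or
    with fewer than [d] favourable letters, loses at once; for [o = true] the parity assumptions
    make the remaining length even, so the loss occurs at an even position. Only suffixes starting
    with a full run of length [d] are left, to be compared through the encodings at the smaller
    position [k1]. *)
Lemma suffix_precedes (o : bool) u w k : coded c d o u w -> Defs.over c d u ->
    u 0 = d -> (o -> [&& ~~ odd c, ~~ odd d & ~~ odd k]) -> 0 < k ->
  precedes o w (isuffix k w) \/
  exists k1, [/\ 0 < k1 < k, ~~ odd k1, u k1 = d & k = psum u k1].
Proof.
move=> cod ov u0 par k_gt0; have u_gt0 := over_gt0 c_gt0 lt_cd ov.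
have [k1 [j [lt_j Ek]]] := psum_cover k u_gt0.
have w0 : w 0 = L o by have := cod 0 0; rewrite addbF; apply.
have [odd_k1|even_k1] := boolP (odd k1).
  left; apply: precedes_head w0 _ => //.
  by rewrite isuffix0 Ek cod // odd_k1 addbT.
have le_d : u k1 <= d by case: (ov k1) => ->; lia.
have [Er|lt_r] := eqVneq (u k1 - j) d.
  right; exists k1; have j0 : j = 0 by lia.
  have uk1 : u k1 = d by lia.
  have k1_gt0 : 0 < k1 by case: (k1) Ek => // Ek; move: k_gt0; rewrite Ek j0.
  split=> //; last by rewrite Ek j0 addn0.
  by rewrite k1_gt0 Ek j0 addn0 ltn_psum // u0; lia.
left; set r := u k1 - j in lt_r.
have Er : k + r = psum u k1.+1 by rewrite Ek /= /r; lia.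
have cod' := coded_mid cod (leq_subr j (u k1)) Er.
rewrite (negPf even_k1) addbF in cod'.
have r_gt0 : 0 < scons r (isuffix k1.+1 u) 0 by rewrite /= /r; lia.
have gt0 : positive (scons r (isuffix k1.+1 u)).
  by apply: scons_gt0 => //; apply: isuffix_gt0.
have lt0 : scons r (isuffix k1.+1 u) 0 < u 0 by rewrite /= u0; lia.
have none i : i < 0 -> scons r (isuffix k1.+1 u) i = u i by [].
have [agree sE wE] := cmp_run gt0 cod' cod none lt0.
exists (psum (scons r (isuffix k1.+1 u)) 1); first by move=> i /agree.
rewrite sE wE /= add0n addbF addbT.
case: (o) par => //= /(_ isT)/and3P[odd_c odd_d odd_k].
suff -> : ~~ odd r by rewrite /letter.
have par_u i : ~~ odd (u i) by case: (ov i) => ->.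
have par_p : ~~ odd (psum u k1).
  by elim: (k1) => //= i IH; rewrite oddD (negPf IH) (negPf (par_u i)).
by have := par_u k1; move: odd_k; rewrite /r Ek oddD oddB ?(ltnW lt_j) //;
  move: par_p; case: (odd _) (odd j) (odd (u k1)) => [] [] [].
Qed.

End Lyndon.

Section Even.

Variables c d : nat.
Hypotheses (c_gt0 : 0 < c) (lt_cd : c < d) (even_c : ~~ odd c) (even_d : ~~ odd d).

Let odd_cd : odd d = odd c. Proof. by rewrite (negPf even_c) (negPf even_d). Qed.

Lemma even_psum u k : Defs.over c d u -> psum u k = (psum u k)./2.*2.
Proof.
by move=> ov; have := odd_psum k odd_cd ov; rewrite (negPf even_c) => /= e; lia.
Qed.

(** All runs start at even positions. A first letter [c] would force [c] at every even position,
    hence at the start of the second run. *)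
Lemma even_minimal_Delta u : smooth c d u -> even_minimal u ->
  u 0 = d /\ even_minimal (Delta u).
Proof.
move=> sm Q; have ovD := smooth_over (smooth_Delta sm).
have D_gt0 := over_gt0 c_gt0 lt_cd ovD.
have u0 : u 0 = d.
  have [u0|//] := smooth_over sm 0.
  have cod := smooth_coded c_gt0 lt_cd sm (b := false) u0.
  have := even_minimal_head c_gt0 lt_cd (psum (Delta u) 1)./2 (smooth_over sm) Q u0.
  by rewrite -even_psum // (coded0 1 D_gt0 cod) /letter /=; lia.
split=> // k k_gt0; have cod := smooth_coded c_gt0 lt_cd sm (b := true) u0.
have cod' := coded_suffix (k := k.*2) cod; rewrite odd_double even_psum // in cod'.
have p_gt0 : 0 < (psum (Delta u) k.*2)./2.
  by have := leq_psum k.*2 D_gt0; rewrite even_psum //; lia.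
have := coded_precedes c_gt0 lt_cd (fun=> odd_cd) ovD (over_isuffix k.*2 ovD) cod cod' (Q _ p_gt0).
by rewrite /next_order even_c.
Qed.

Lemma even_minimal_greedy u : smooth c d u -> even_minimal u -> greedy c d true u.
Proof.
move=> sm Q k; elim: k u sm Q => [|k IH] u sm Q.
  by rewrite /=; have [->] := even_minimal_Delta sm Q.
rewrite !iterSr {2}/next_order even_c orbT.
by have [_] := even_minimal_Delta sm Q; apply: IH; apply: smooth_Delta.
Qed.

Lemma greedy_even_minimal k u : smooth c d u -> greedy c d true u -> 0 < k ->
  ~~ odd k -> precedes true u (isuffix k u).
Proof.
elim/ltn_ind: k u => k IH u sm gr k_gt0 even_k.
have cod := smooth_coded c_gt0 lt_cd sm (greedy0 gr).
have grD := greedy_Delta gr; rewrite /next_order even_c orbT in grD.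
have ovD := smooth_over (smooth_Delta sm).
have par : true -> [&& ~~ odd c, ~~ odd d & ~~ odd k] by rewrite even_c even_d.
have [//|[k1 [/andP[k1_gt0 lt_k1] even_k1 D1 ->]]] :=
  suffix_precedes c_gt0 lt_cd cod ovD (greedy0 grD) par k_gt0.
have cod' := coded_suffix (k := k1) cod; rewrite (negPf even_k1) in cod'.
apply: (precedes_coded c_gt0 lt_cd (fun=> odd_cd) ovD (over_isuffix _ ovD) cod cod').
by rewrite /next_order even_c; apply: IH => //; apply: smooth_Delta.
Qed.

Lemma even_LyndonP w : smooth c d w -> infinite_Lyndon w <-> minimal_smooth c d w.
Proof.
move=> sm; rewrite (minimal_greedyP c_gt0 lt_cd odd_cd sm).
have smD := smooth_Delta sm; split=> [lyn|gr k k_gt0].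
  have [w0 Q] := Lyndon_Delta c_gt0 lt_cd sm lyn.
  by apply: (greedyS (o := false) w0); apply: even_minimal_greedy.
have cod := smooth_coded c_gt0 lt_cd sm (greedy0 gr).
have grD := greedy_Delta gr; have ovD := smooth_over smD.
have par : false -> [&& ~~ odd c, ~~ odd d & ~~ odd k] by [].
have [//|[k1 [/andP[k1_gt0 lt_k1] even_k1 D1 ->]]] :=
  suffix_precedes c_gt0 lt_cd cod ovD (greedy0 grD) par k_gt0.
have cod' := coded_suffix (k := k1) cod; rewrite (negPf even_k1) in cod'.
apply: (precedes_coded (o := false) c_gt0 lt_cd _ ovD (over_isuffix _ ovD) cod cod') => //.
exact: greedy_even_minimal.
Qed.

End Even.

(** * Odd letters *)

Section Odd.

Variables c d : nat.
Hypotheses (c_gt0 : 0 < c) (lt_cd : c < d) (odd_c : odd c) (odd_d : odd d).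

Notation L := (letter c d).

Let odd_cd : odd d = odd c. Proof. by rewrite odd_c odd_d. Qed.

Lemma odd_psumE u k : Defs.over c d u -> odd (psum u k) = odd k.
Proof. by move=> ov; rewrite (odd_psum k odd_cd ov) odd_c. Qed.

Lemma even_minimal_const u : smooth c d u -> even_minimal u -> u 0 = c ->
  [/\ c = 1, forall k, u k.*2 = c, even_minimal (Delta u) & Delta u 0 = d].
Proof.
move=> sm Q u0; have ov := smooth_over sm.
have u_even k : u k.*2 = c by apply: (even_minimal_head c_gt0 lt_cd).
have [c1 D_odd] := even_const_runs c_gt0 lt_cd sm u_even.
have smD := smooth_Delta sm; have ovD := smooth_over smD.
have D_gt0 := over_gt0 c_gt0 lt_cd ovD.
have cod := smooth_coded c_gt0 lt_cd sm (b := false) u0.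
have QD : even_minimal (Delta u).
  move=> k k_gt0; have cod' := coded_suffix (k := k.*2) cod.
  rewrite odd_double (even_halfE (n := psum _ _)) ?odd_psumE ?odd_double // in cod'.
  set q := (psum _ _)./2 in cod'.
  have q_gt0 : 0 < q.
    have := leq_psum k.*2 D_gt0; have := odd_psumE k.*2 ovD.
    by rewrite odd_double /q; lia.
  (* All even positions carry [c], so the first difference sits at an odd position, where the two
     orders agree. *)
  have lt_u : precedes false u (isuffix q.*2 u).
    have [n same lt_n] := Q _ q_gt0; exists n => //=.
    move: lt_n; have [//|even_n] := boolP (odd n).
    by rewrite /= /isuffix (even_halfE even_n) -doubleD !u_even ltnn.
  exact: (coded_precedes (o := false) c_gt0 lt_cd _ ovD (over_isuffix k.*2 ovD) cod cod').
split=> //.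
(* With [c] as its first letter, [Delta u] would be constant. *)
have [D0|//] := ovD 0.
have D1 k : Delta u k = c.
  have [odd_k|/even_halfE->] := boolP (odd k); first by rewrite D_odd.
  exact: (even_minimal_head c_gt0 lt_cd).
by have [n _] := smooth_occurs c_gt0 lt_cd true 0 smD; rewrite D1 /letter; lia.
Qed.

Lemma coded_scons b r u w : coded c d (~~ b) u w -> r = 1 ->
  coded c d b (scons r u) (scons (L b) w).
Proof.
move=> cod -> [|k] j; first by case: j => // _; rewrite addbF.
move=> lt_j; rewrite psum_scons -addnA add1n /= cod //.
by case: (b) (odd k) => [] [].
Qed.

Lemma over_scons a u : a = c \/ a = d -> Defs.over c d u -> Defs.over c d (scons a u).
Proof. by move=> ca ov []. Qed.

(** The alternating condition on [u] becomes a lexicographic one on [x] and again an alternating one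
    on [z]. Each first letter is forced by exhibiting a suffix of [u] that would otherwise be too
    small. *)
Lemma even_minimal_max u : smooth c d u -> even_minimal u -> u 0 = d ->
  [/\ c = 1, Delta u 0 = c, even_minimal (Delta (Delta u)) & Delta (Delta u) 0 = d].
Proof.
move=> sm Q u0; have smx := smooth_Delta sm; have smz := smooth_Delta smx.
set x := Delta u in smx smz *; set z := Delta x in smz *.
have [[ovu ovx] ovz] := (smooth_over sm, smooth_over smx, smooth_over smz).
have x_gt0 := over_gt0 c_gt0 lt_cd ovx; have z_gt0 := over_gt0 c_gt0 lt_cd ovz.
have cod := smooth_coded c_gt0 lt_cd sm (b := true) u0.
have odd_x k : odd (x k) by case: (ovx k) => ->.
have x0 : x 0 = 1.
  (* Otherwise [u] and its shift by 2 first differ at the odd position [x 0 - 2], where the shift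
     already has [c]. *)
  apply/eqP; rewrite eqn_leq x_gt0 andbT leqNgt; apply/negP => x0_gt1.
  have odd_x0 := odd_x 0; have u_lt i : i < x 0 -> u i = d by apply: (cod 0).
  have ux0 : u (x 0) = c by have := coded0 1 x_gt0 cod; rewrite /= add0n.
  have eqn : 2 + (x 0 - 2) = x 0 by lia.
  have := precedes_at (n := x 0 - 2) (Q 1 isT); rewrite /isuffix eqn ux0 u_lt; last by lia.
  have -> : odd (x 0 - 2) by lia.
  suff same i : i < x 0 - 2 -> u i = u (1.*2 + i).
    by move=> /(_ same); rewrite gtn_eqF // => /(_ isT) /=; lia.
  by move=> lt_i; rewrite !u_lt //; lia.
have c1 : c = 1 by move: x0; case: (ovx 0) => ->; lia.
have codx : coded c d false z x.
  by apply: (smooth_coded c_gt0 lt_cd smx); rewrite x0 -c1.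
have x_min k : 0 < k -> precedes false x (isuffix k.*2 x).
  move=> k_gt0; have cod' := coded_suffix (k := k.*2) cod.
  rewrite odd_double (even_halfE (n := psum _ _)) ?odd_psumE ?odd_double // in cod'.
  have q_gt0 : 0 < (psum x k.*2)./2.
    by have := leq_psum k.*2 x_gt0; have := odd_psumE k.*2 ovx; rewrite odd_double; lia.
  have := coded_precedes c_gt0 lt_cd (fun=> odd_cd) ovx (over_isuffix k.*2 ovx)
    cod cod' (Q _ q_gt0).
  by rewrite /next_order odd_c.
have Qz : even_minimal z.
  move=> k k_gt0; have cod' := coded_suffix (k := k.*2) codx.
  rewrite odd_double (even_halfE (n := psum _ _)) ?odd_psumE ?odd_double // in cod'.
  have q_gt0 : 0 < (psum z k.*2)./2.
    by have := leq_psum k.*2 z_gt0; have := odd_psumE k.*2 ovz; rewrite odd_double; lia.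
  exact: (coded_precedes (o := false) c_gt0 lt_cd _ ovz
    (over_isuffix k.*2 ovz) codx cod' (x_min _ q_gt0)).
split=> //; first by rewrite x0 c1.
(* If [z 0 = c], every [d] in [z] is isolated; the contradiction comes from a block of [d] ones of
   [z] at a position [p > 0], preceded by a single [d]. *)
have [z0|//] := ovz 0; exfalso.
have z_even k : z k.*2 = 1 by rewrite -c1; apply: (even_minimal_head c_gt0 lt_cd).
have smt := smooth_Delta smz; set t := Delta z in smt.
have ovt := smooth_over smt; have t_gt0 := over_gt0 c_gt0 lt_cd ovt.
have [_ t_odd] : c = 1 /\ forall k, odd k -> t k = 1.
  by apply: (even_const_runs c_gt0 lt_cd smz) => k; rewrite z_even c1.
have codz := smooth_coded c_gt0 lt_cd smz (b := false) z0.
have [k k_gt0 tk] := smooth_occurs c_gt0 lt_cd true 1 smt.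
have even_k : ~~ odd k by apply/negP => /t_odd; rewrite tk /letter; lia.
case: k k_gt0 even_k tk => // k _; rewrite oddS negbK => odd_k tk.
pose p := psum t k.+1.
have pE : p = (psum t k).+1 by rewrite /p /= t_odd ?addn1.
have zp1 : z p.-1 = d by rewrite pE /= (coded0 k t_gt0 codz) odd_k.
have even_p : odd p = false by rewrite odd_psumE ?oddS ?odd_k.
have zp i : i < d -> z (p + i) = 1.
  by move=> lt_i; rewrite codz 1?oddS 1?odd_k // -/t tk.
(* The run of [x] ending before [psum z p] has length [d], and [e] is its last position but one. The
   suffix of [u] from the last letter of run [e] is encoded by 1 followed by [x] from [e.+1], and
   this word by two ones followed by [z] from [p]. *)
pose e := psum z p - 2.
have psE : psum z p = psum z p.-1 + d by rewrite pE /= -zp1 pE.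
have odd_p1 : odd p.-1 by rewrite pE /= odd_psumE.
have odd_s : odd (psum z p.-1) by rewrite odd_psumE.
have eE : psum z p = e + 2 by rewrite /e; lia.
have even_e : ~~ odd e by have := odd_psumE p ovz; rewrite eE; lia.
have xe : x e = d.
  have -> : e = psum z p.-1 + (d - 2) by lia.
  by rewrite codx ?zp1 ?odd_p1 //; lia.
have e_gt0 : 0 < e by move: odd_d odd_s eE; rewrite psE; lia.
have lt_x : precedes false x (scons 1 (isuffix e.+1 x)).
  have q_even : psum x e.+1 - 1 = (psum x e.+1 - 1)./2.*2.
    by have := odd_psumE e.+1 ovx; have := leq_psum e.+1 x_gt0; rewrite /= ; lia.
  have q1 : psum x e.+1 - 1 + 1 = psum x e.+1.
    by have := leq_psum e.+1 x_gt0; lia.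
  have le1 : 1 <= x e by [].
  have cod' := coded_mid cod le1 q1; rewrite (negPf even_e) q_even in cod'.
  have q_gt0 : 0 < (psum x e.+1 - 1)./2 by have := leq_psum e.+1 x_gt0; lia.
  have ovs : Defs.over c d (scons 1 (isuffix e.+1 x)).
    by apply: over_scons; [left|apply: over_isuffix].
  have := coded_precedes c_gt0 lt_cd (fun=> odd_cd) ovx ovs cod cod' (Q _ q_gt0).
  by rewrite /next_order odd_c.
have lt_z : precedes true z (scons 1 (scons 1 (isuffix p z))).
  have cod1 : coded c d true (scons 1 (isuffix p z)) (isuffix e.+1 x).
    have le1 : 1 <= z p.-1 by [].
    have := coded_mid (q := e.+1) codx le1; rewrite odd_p1 pE -pE; apply.
    by rewrite eE; lia.
  have L1 : L false = 1 by [].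
  have cod2 := coded_scons (b := false) cod1 erefl; rewrite L1 in cod2.
  have ovs : Defs.over c d (scons 1 (scons 1 (isuffix p z))).
    by do 2?[apply: over_scons; first by left]; apply: over_isuffix.
  exact: (coded_precedes (o := false) c_gt0 lt_cd _ ovz ovs codx cod2 lt_x).
have z1 : z 1 = 1.
  have [->//|z1] := ovz 1.
  have := precedes_at (n := 1) lt_z; rewrite z1 /=.
  suff same i : i < 1 -> z i = scons 1 (scons 1 (isuffix p z)) i.
    by move=> /(_ same); rewrite gtn_eqF //; lia.
  by case: i => //= _; rewrite z0 c1.
have t0 : t 0 = d.
  have [t0|//] := ovt 0; have := coded0 1 t_gt0 codz.
  by rewrite /= add0n -/t t0 c1 z1 /letter; lia.
have z_lt i : i < d -> z i = 1.
  by rewrite -t0 => /(codz 0); rewrite add0n /letter /= c1.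
have zd : z d = d by have := coded0 1 t_gt0 codz; rewrite /= add0n -/t t0.
(* [z] begins with exactly [d] ones and its competitor with at least [d + 2]; at the odd position
   [d] the larger letter of [z] loses. *)
have := precedes_at (n := d) lt_z; rewrite zd odd_d andbF.
have other i : i <= d -> scons 1 (scons 1 (isuffix p z)) i = 1.
  by case: i => [|[|i]] //= lt_i; apply: zp; lia.
suff same i : i < d -> z i = scons 1 (scons 1 (isuffix p z)) i.
  by rewrite other // => /(_ same); rewrite gtn_eqF; lia.
by move=> lt_i; rewrite z_lt // other // ltnW.
Qed.

Lemma next_true : next_order c true = false.
Proof. by rewrite /next_order odd_c. Qed.

Lemma even_minimal_max_greedy u : smooth c d u -> even_minimal u -> u 0 = d ->
  greedy c d true u.
Proof.
move=> sm Q u0 k; elim/ltn_ind: k u sm Q u0 => -[|[|k]] IH u sm Q u0 //.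
  by have [_ D0 _ _] := even_minimal_max sm Q u0; rewrite /= next_true.
rewrite !iterSr next_true; have [_ _ QDD DD0] := even_minimal_max sm Q u0.
by apply: (IH k) => //; apply/smooth_Delta/smooth_Delta.
Qed.

(** A [d] at a position of the given parity would have an odd offset in its run, whose length is 1
    by the other half of the statement. The second half may call the first one at the same [n]. *)
Lemma greedy_letters n : c = 1 ->
  (forall m, smooth c d m -> greedy c d false m -> m n.*2 = c) /\
  (forall u, smooth c d u -> greedy c d true u -> u n.*2.+1 = c).
Proof.
move=> c1; elim/ltn_ind: n => n IH.
have even_m m : smooth c d m -> greedy c d false m -> m n.*2 = c.
  move=> sm gr; have smD := smooth_Delta sm; have ovD := smooth_over smD.
  have D_gt0 := over_gt0 c_gt0 lt_cd ovD.
  have cod := smooth_coded c_gt0 lt_cd sm (greedy0 gr).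
  have [k [j [lt_j En]]] := psum_cover n.*2 D_gt0; rewrite En cod //=.
  have [odd_k|//] := boolP (odd k).
  have odd_j : odd j by have := odd_psumE k ovD; rewrite odd_k; lia.
  have Ek : k = k./2.*2.+1 by lia.
  have lt_k : k./2 < n by have := leq_psum k D_gt0; lia.
  have [_ odd_u] := IH _ lt_k; move: lt_j; rewrite Ek odd_u //; first by lia.
  exact: (greedy_Delta gr).
split=> // u sm gr; have smD := smooth_Delta sm; have ovD := smooth_over smD.
have D_gt0 := over_gt0 c_gt0 lt_cd ovD.
have cod := smooth_coded c_gt0 lt_cd sm (greedy0 gr).
have grD := greedy_Delta gr; rewrite next_true in grD.
have [k [j [lt_j En]]] := psum_cover n.*2.+1 D_gt0; rewrite En cod //=.
have [//|even_k] := boolP (odd k).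
have odd_j : odd j by have := odd_psumE k ovD; rewrite (negPf even_k); lia.
suff Dk : Delta u k = c by lia.
have Ek := even_halfE even_k; rewrite Ek.
have [lt_k|le_k] := ltnP k./2 n; first by have [even_m' _] := IH _ lt_k; apply: even_m'.
have -> : k./2 = n by have := leq_psum k D_gt0; lia.
exact: even_m.
Qed.

(** The descent takes two encodings at a time. In the case left by [suffix_precedes], [k1] lies in a
    [d]-run of [Delta m] of even index; this run has length 1 by [greedy_letters], so [k1] is its
    start and the comparison passes to [Delta (Delta m)], again in lexicographic order. *)
Lemma greedy_Lyndon m : c = 1 -> smooth c d m -> greedy c d false m ->
  infinite_Lyndon m.
Proof.
move=> c1 sm gr k; elim/ltn_ind: k m sm gr => k IH m sm gr k_gt0.
have smD := smooth_Delta sm; have smDD := smooth_Delta smD.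
have [ovD ovDD] := (smooth_over smD, smooth_over smDD).
have D_gt0 := over_gt0 c_gt0 lt_cd ovD; have DD_gt0 := over_gt0 c_gt0 lt_cd ovDD.
have cod := smooth_coded c_gt0 lt_cd sm (greedy0 gr).
have grD := greedy_Delta gr; have grDD := greedy_Delta grD; rewrite next_true in grDD.
have codD := smooth_coded c_gt0 lt_cd smD (greedy0 grD).
have par : false -> [&& ~~ odd c, ~~ odd d & ~~ odd k] by [].
have [//|[k1 [/andP[k1_gt0 lt_k1] even_k1 D1 Ek]]] :=
  suffix_precedes c_gt0 lt_cd cod ovD (greedy0 grD) par k_gt0.
have [k2 [j [lt_j Ek1]]] := psum_cover k1 DD_gt0.
have even_k2 : ~~ odd k2.
  by apply/negP => odd_k2; move: D1; rewrite Ek1 codD //= odd_k2 /letter /=; lia.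
have DD2 : Delta (Delta m) k2 = c.
  have [even_m _] := greedy_letters k2./2 c1.
  by rewrite (even_halfE even_k2) even_m.
have {}Ek1 : k1 = psum (Delta (Delta m)) k2 by lia.
have k2_gt0 : 0 < k2 by case: (k2) Ek1 k1_gt0 => //= ->.
have lt_k2 : k2 < k by have := leq_psum k2 DD_gt0; lia.
have codD' := coded_suffix (k := k2) codD; rewrite (negPf even_k2) -Ek1 in codD'.
have cod' := coded_suffix (k := k1) cod; rewrite (negPf even_k1) -Ek in cod'.
apply: (precedes_coded (o := false) c_gt0 lt_cd _ ovD (over_isuffix k1 ovD) cod cod') => //.
apply: (precedes_coded (o := true) c_gt0 lt_cd (fun=> odd_cd) ovDD
  (over_isuffix k2 ovDD) codD codD').
by rewrite next_true; apply: IH.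
Qed.

(** The even positions of [Delta w] carry 1. Hence every suffix of [w] beginning with [c] starts at
    a run, and the encodings first differ at an odd position, where the two orders agree. *)
Lemma greedy_Delta_Lyndon w : c = 1 -> smooth c d w -> w 0 = c ->
  greedy c d false (Delta w) -> infinite_Lyndon w.
Proof.
move=> c1 sm w0 gr k k_gt0; have smD := smooth_Delta sm; have ovD := smooth_over smD.
have D_gt0 := over_gt0 c_gt0 lt_cd ovD.
have cod := smooth_coded c_gt0 lt_cd sm (b := false) w0.
have even_D i : Delta w i.*2 = c by have [even_m _] := greedy_letters i c1; apply: even_m.
have [k1 [j [lt_j Ek]]] := psum_cover k D_gt0.
have [odd_k1|even_k1] := boolP (odd k1).
  apply: (precedes_head lt_cd (o := false)) => //.
  by rewrite isuffix0 Ek cod // odd_k1.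
have {}Ek : k = psum (Delta w) k1.
  by move: lt_j; rewrite (even_halfE even_k1) even_D -even_halfE //; lia.
have k1_gt0 : 0 < k1 by case: (k1) Ek k_gt0 => //= ->.
have cod' := coded_suffix (k := k1) cod; rewrite (negPf even_k1) -Ek in cod'.
apply: (precedes_coded (o := false) c_gt0 lt_cd _ ovD (over_isuffix k1 ovD) cod cod') => //.
have [n same lt_n] := greedy_Lyndon c1 smD gr k1_gt0; exists n => //.
have [odd_n|even_n] := boolP (odd n); first by rewrite andbF.
move: lt_n; rewrite /isuffix (even_halfE even_n) (even_halfE even_k1).
by rewrite -doubleD !even_D ltnn.
Qed.

Lemma odd_LyndonP w : smooth c d w ->
  infinite_Lyndon w <->
  c = 1 /\ (minimal_smooth c d w \/
            exists2 m, minimal_smooth c d m & w = Delta_inv c d c m).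
Proof.
move=> sm; have smD := smooth_Delta sm; split.
  move=> /(Lyndon_Delta c_gt0 lt_cd sm)[w0 Q].
  have [D0|D0] := smooth_over smD 0; last first.
    have [c1 _ _ _] := even_minimal_max smD Q D0; split=> //; left.
    apply/(minimal_greedyP c_gt0 lt_cd odd_cd sm)/(greedyS (o := false) w0).
    exact: even_minimal_max_greedy.
  have [c1 _ QD DD0] := even_minimal_const smD Q D0; split=> //; right.
  exists (Delta w).
    apply/(minimal_greedyP c_gt0 lt_cd odd_cd smD)/(greedyS (o := false) D0).
    by apply: even_minimal_max_greedy => //; apply: smooth_Delta.
  have D_gt0 := smooth_gt0 c_gt0 lt_cd smD.
  apply: (coded_eq D_gt0 (smooth_coded c_gt0 lt_cd sm (b := false) w0)).
  exact: (Delta_inv_coded c_gt0 lt_cd false D_gt0).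
move=> [c1 [/(minimal_greedyP c_gt0 lt_cd odd_cd sm)|[m m_min Ew]]].
  exact: greedy_Lyndon.
have smm : smooth c d m by case: m_min.
have [_ Em cod] := smooth_Delta_inv c_gt0 lt_cd false smm.
rewrite -[c in Delta_inv c d c]/(L false) in Ew; rewrite -Ew in Em cod.
apply: greedy_Delta_Lyndon => //.
  by have := cod 0 0; apply; apply: (smooth_gt0 c_gt0 lt_cd smm).
by rewrite Em; apply/(minimal_greedyP c_gt0 lt_cd odd_cd smm).
Qed.

End Odd.

(** * Letters of different parities *)

Lemma psum_const u n a : (forall i, i < n -> u i = a) -> psum u n = n * a.
Proof.
elim: n => //= n IH const; rewrite IH ?const ?mulSnr // => i lt_in.
by apply: const; apply: ltnW.
Qed.

Section Mixed.

Variables c d : nat.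
Hypotheses (c_gt0 : 0 < c) (lt_cd : c < d) (odd_dc : odd d = ~~ odd c).

Notation L := (letter c d).

(** If [u 0 = c], then [c = 1] and the [d]-runs are single letters at odd positions. A [c]-run of
    even length [d] would shift the next one to an even position, so [Delta u] would be constant. *)
Lemma mixed_head u : smooth c d u -> even_minimal u -> u 0 = d.
Proof.
move=> sm Q; have [u0|//] := smooth_over sm 0; exfalso.
have u_even k : u k.*2 = c by apply: (even_minimal_head c_gt0 lt_cd _ (smooth_over sm)).
have [c1 D_odd] := even_const_runs c_gt0 lt_cd sm u_even.
have smD := smooth_Delta sm; have ovD := smooth_over smD.
have D_gt0 := over_gt0 c_gt0 lt_cd ovD.
have cod := smooth_coded c_gt0 lt_cd sm (b := false) u0.
have odd_p k : odd k -> odd (psum (Delta u) k).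
  move=> odd_k; apply/negPn/negP => /even_halfE Ep.
  have := coded0 k D_gt0 cod; rewrite Ep u_even odd_k /letter /=; lia.
have D1 k : Delta u k = c.
  have [odd_k|even_k] := boolP (odd k); first by rewrite D_odd.
  case: (ovD k) => // Dk; have := odd_p k.+1; rewrite /= even_k => /(_ isT).
  rewrite oddD Dk odd_dc c1 addbF; case: (k) even_k => // k' /=.
  rewrite negbK => odd_k'; rewrite D_odd // oddD odd_p //=.
by have [n _] := smooth_occurs c_gt0 lt_cd true 0 smD; rewrite D1 /letter; lia.
Qed.

(** The suffix compared with [u] starts with the remaining [Delta u k - j] letters [d] of run [k].
    The shorter initial run decides: if it belongs to the suffix it must end at an even position, if
    it belongs to [u] at an odd one. *)
Lemma run_rule u k j : smooth c d u -> even_minimal u -> u 0 = d -> ~~ odd k ->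
    j < Delta u k -> ~~ odd (psum (Delta u) k + j) -> 0 < psum (Delta u) k + j ->
  (Delta u k - j < Delta u 0 -> ~~ odd (Delta u k - j)) /\
  (Delta u 0 < Delta u k - j -> odd (Delta u 0)).
Proof.
move=> sm Q u0 even_k lt_j even_q q_gt0; set x := Delta u in lt_j even_q q_gt0 *.
have smx := smooth_Delta sm; have x_gt0 := smooth_gt0 c_gt0 lt_cd smx.
have cod : coded c d true (Delta u) u := smooth_coded c_gt0 lt_cd sm (b := true) u0.
set r := x k - j; set q := psum x k + j in even_q q_gt0.
have Eq : q + r = psum x k.+1 by rewrite /q /r /=; lia.
have cod' := coded_mid cod (leq_subr j (x k)) Eq; rewrite (negPf even_k) -/r in cod'.
have q2 : q = q./2.*2 by exact: even_halfE.
have lt_u := Q q./2; rewrite -q2 in lt_u.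
have {}lt_u : precedes true u (isuffix q u) by apply: lt_u; lia.
set y := scons r (isuffix k.+1 x) in cod'.
have y_gt0 : positive y by apply: scons_gt0; [rewrite /r; lia|apply: isuffix_gt0].
split=> lt_r.
  apply/negP => par; have none i : i < 0 -> y i = x i by [].
  have [agree sE uE] := cmp_run y_gt0 cod' cod none lt_r.
  rewrite /= add0n in agree sE uE.
  have := precedes_at lt_u (fun i lt_i => esym (agree i lt_i)).
  by rewrite sE uE /letter par /=; lia.
apply/negPn/negP => par; have none i : i < 0 -> x i = y i by [].
have [agree uE sE] := cmp_run x_gt0 cod cod' none lt_r.
rewrite /= add0n in agree sE uE.
have := precedes_at lt_u agree.
by rewrite sE uE /letter par /=; lia.
Qed.

(* Otherwise the length of every d-run of [u] has the parity of its position, so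
   that the letters of [Delta u] after the first come in equal pairs, and
   [Delta (Delta u)] is constant after its first letter. *)
Lemma mixed_first_run u : smooth c d u -> even_minimal u -> u 0 = d ->
  c = 1 /\ Delta u 0 = c.
Proof.
move=> sm Q u0; set x := Delta u.
have smx : smooth c d x := smooth_Delta sm.
have ovx := smooth_over smx; have x_gt0 := over_gt0 c_gt0 lt_cd ovx.
apply: contrapT => not1.
have rule k j := @run_rule u k j sm Q u0.
have even_x0 : ~~ odd (x 0).
  apply/negP => odd_x0; have x0_gt2 : 2 < x 0.
    by have := ovx 0; have := x_gt0 0; lia.
  by have := rule 0 2; rewrite -/x /= add0n; lia.
have par k : ~~ odd k -> odd (x k) = odd (psum x k).
  move=> even_k; have [->|k_gt0] := posnP k; first by rewrite (negPf even_x0).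
  have p_gt0 : 0 < psum x k by have := leq_psum k x_gt0; lia.
  have := ovx k; have := ovx 0; have := x_gt0 k.
  have [odd_p|even_p] := boolP (odd (psum x k)).
    have := rule k 1 even_k; rewrite -/x; lia.
  have := rule k 0 even_k; rewrite -/x; lia.
have pair k : ~~ odd k -> x k.+2 = x k.+1.
  move=> even_k; have := par k.+2; rewrite /= negbK => /(_ even_k).
  have := par k even_k; have := ovx k.+2; have := ovx k.+1; lia.
have smz := smooth_Delta smx; set z := Delta x in smz.
have ovz := smooth_over smz; have z_gt0 := over_gt0 c_gt0 lt_cd ovz.
have codx := smooth_coded c_gt0 lt_cd smx (over_letter lt_cd 0 ovx).
(* A run of [x] starting at an even position would split one of the equal pairs. *)
have odd_p i : odd (psum z i.+1).
  apply/negPn/negP => even_p; set p := psum z i.+1 in even_p.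
  have p_gt0 : 1 < p by have := leq_psum i.+1 z_gt0; rewrite -/p; lia.
  have Ep : p = (p - 2).+2 by lia.
  have := coded0 i.+1 z_gt0 codx; rewrite -/p Ep pair; last by lia.
  have -> : (p - 2).+1 = psum z i + (z i - 1).
    by have := z_gt0 i; move: Ep; rewrite /p /=; lia.
  rewrite codx; last by have := z_gt0 i; rewrite -/z; lia.
  by move=> /(letter_inj c_gt0 lt_cd); rewrite oddS; case: (x 0 == d) (odd i) => [] [].
(* [letter c d (odd d)] is the odd letter, which cannot be the distance between two odd
   positions. *)
have [n n_gt0 zn] := smooth_occurs c_gt0 lt_cd (odd d) 1 smz.
have odd_pn : odd (psum z n) by rewrite -(prednK n_gt0).
have := odd_p n; rewrite /= oddD odd_pn zn /letter.
by move: odd_dc; case: ifP => [-> //|_]; case: (odd c).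
Qed.

(** [u] begins with [d c c]. If run [a] had length 1, the suffix from the letter before it would
    begin with [d c d] and be smaller at position 2. *)
Lemma mixed_long_second u a : smooth c d u -> even_minimal u -> u 0 = d ->
    Delta u 0 = 1 -> Delta u 1 = d -> odd a -> odd (psum (Delta u) a) ->
  Delta u a = d.
Proof.
move=> sm Q u0 v0 v1 odd_a odd_p; set v := Delta u in v0 v1 odd_p *.
have smv : smooth c d v := smooth_Delta sm; have ovv := smooth_over smv.
have v_gt0 := over_gt0 c_gt0 lt_cd ovv.
case: (ovv a) => // va.
have c1 : c = 1 by have := ovv 0; rewrite -/v; lia.
have cod : coded c d true v u := smooth_coded c_gt0 lt_cd sm (b := true) u0.
have aS : a = a.-1.+1 by lia.
have a_gt1 : 1 < a by case: (a) va odd_a => [|[|a']] //; rewrite -/v v1; lia.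
have p_gt := leq_psum a v_gt0.
have le1 : 1 <= v a.-1 by [].
have Eq : psum v a - 1 + 1 = psum v a.-1.+1 by rewrite -aS; lia.
have cod' := coded_mid cod le1 Eq; rewrite -aS in cod'.
have odd_a1 : odd a.-1 = false by lia.
rewrite odd_a1 in cod'.
have lt_u := Q (psum v a - 1)./2; rewrite -even_halfE in lt_u; last by lia.
set q := psum v a - 1 in cod' lt_u.
have {}lt_u : precedes true u (isuffix q u) by apply: lt_u; rewrite /q; lia.
have y_gt0 : positive (scons 1 (isuffix a v)) by apply: scons_gt0 => //; apply: isuffix_gt0.
have same i : i < 1 -> scons 1 (isuffix a v) i = v i by case: i => //=; rewrite v0.
have lt1 : scons 1 (isuffix a v) 1 < v 1 by rewrite /= isuffix0 va v1.
have [agree sE uE] := cmp_run y_gt0 cod' cod same lt1.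
rewrite /= isuffix0 va c1 in agree sE uE.
have := precedes_at lt_u (fun i lt_i => esym (agree i lt_i)).
by rewrite sE uE /letter /=; lia.
Qed.

(** The suffix from the letter before run [a] would have an encoding beginning with [d + 1] ones,
    against [d] ones and a [d] for [u]. At the odd position [d + 1] it has [c] where [u] has [d]. *)
Lemma mixed_long_first u a : smooth c d u -> even_minimal u -> u 0 = d ->
    c = 1 -> (forall i, i < d -> Delta u i = 1) -> Delta u d = d ->
    odd a -> odd (psum (Delta u) a) -> ~ (forall i, i < d -> Delta u (a + i) = 1).
Proof.
move=> sm Q u0 c1 v_lt vd odd_a odd_p va; set v := Delta u in v_lt vd odd_p va *.
have smv : smooth c d v := smooth_Delta sm; have ovv := smooth_over smv.
have v_gt0 := over_gt0 c_gt0 lt_cd ovv.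
have cod : coded c d true v u := smooth_coded c_gt0 lt_cd sm (b := true) u0.
have aS : a = a.-1.+1 by lia.
have a_gt1 : 1 < a.
  case: (a) va odd_a => [|[|a']] // /(_ d.-1); rewrite add1n prednK; last by lia.
  by rewrite -/v vd; lia.
have p_gt := leq_psum a v_gt0.
have le1 : 1 <= v a.-1 by [].
have Eq : psum v a - 1 + 1 = psum v a.-1.+1 by rewrite -aS; lia.
have cod' := coded_mid cod le1 Eq; rewrite -aS in cod'.
have odd_a1 : odd a.-1 = false by lia.
rewrite odd_a1 in cod'.
have lt_u := Q (psum v a - 1)./2; rewrite -even_halfE in lt_u; last by lia.
set q := psum v a - 1 in cod' lt_u.
have {}lt_u : precedes true u (isuffix q u) by apply: lt_u; rewrite /q; lia.
set y := scons 1 (isuffix a v) in cod'.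
have y_gt0 : positive y by apply: scons_gt0 => //; apply: isuffix_gt0.
have y1 i : i < d.+1 -> y i = 1 by case: i => //= i; apply: va.
have same i : i < d -> y i = v i by move=> lt_i; rewrite y1 ?v_lt //; lia.
have ltd : y d < v d by rewrite y1 // vd; lia.
have [agree sE uE] := cmp_run y_gt0 cod' cod same ltd.
rewrite (psum_const y1) muln1 in agree sE uE.
have := precedes_at lt_u (fun i lt_i => esym (agree i lt_i)).
have even_d : odd d = false by rewrite odd_dc c1.
by rewrite sE uE /letter oddS even_d /=; lia.
Qed.

End Mixed.

(** * A finite search for violated parity constraints *)

Section OptionIteration.

Variable T : Type.

Fixpoint oiter (k : nat) (f : T -> option T) (q : T) : option T :=
  if k is k'.+1 then obind (oiter k' f) (f q) else Some q.

Lemma oiterD k l f q : oiter (k + l) f q = obind (oiter l f) (oiter k f q).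
Proof. by elim: k q => //= k IH q; case: (f q). Qed.

Lemma oiter_path f (s : nat -> T) p k :
  (forall j, j < k -> f (s (p + j)) = Some (s (p + j).+1)) ->
  oiter k f (s p) = Some (s (p + k)).
Proof.
elim: k p => [|k IH] p step; first by rewrite addn0.
have := step 0 isT; rewrite addn0 /= => -> /=.
by rewrite IH ?addSnnS // => j lt_j; rewrite addSnnS; apply: step.
Qed.

Lemma oiter_fixed k m f q : oiter k f q = Some q -> oiter (k * m) f q = Some q.
Proof. by move=> fix_q; elim: m => [|m IH]; rewrite ?muln0 // mulnS oiterD fix_q. Qed.

End OptionIteration.

(* The reader of [x = Delta v] tracks in [q] the parities of its position [n] in
   [x], of [psum x n] and of [psum v (psum x n)]; [None] means that the constraint
   [bad] is violated.  Level [n.+1] reads the run-length encoding of the word read at level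
   [n], and its states start with the letter of the current run. *)
Definition base_step (bad : bool -> bool -> bool -> bool -> bool) (b : bool)
    (q : seq bool) : option (seq bool) :=
  if q is [:: i; a; s] then
    if bad i a s b then None
    else Some [:: ~~ i; if b then a else ~~ a; if b then s else s (+) ~~ i]
  else None.

Section Automaton.

Variables (d : nat) (bad : bool -> bool -> bool -> bool -> bool).

Fixpoint level_step (n : nat) (b : bool) (q : seq bool) : option (seq bool) :=
  if n is n'.+1 then
    if q is l :: q' then
      omap (cons (~~ l)) (oiter (if b then d else 1) (level_step n' l) q')
    else None
  else base_step bad b q.

Inductive outcome := Violated | Reached of seq bool | Unknown.

Definition describes (o : outcome) (r : option (seq bool)) : Prop :=
  match o with
  | Violated => r = None
  | Reached q => r = Some q
  | Unknown => True
  end.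

Definition of_option (r : option (seq bool)) : outcome :=
  if r is Some q then Reached q else Violated.

Definition then_do (o : outcome) (f : seq bool -> outcome) : outcome :=
  if o is Reached q then f q else o.

Fixpoint eval_iter (k : nat) (f : seq bool -> outcome) (q : seq bool) : outcome :=
  if k is k'.+1 then then_do (f q) (eval_iter k' f) else Reached q.

Fixpoint eqbits (s t : seq bool) : bool :=
  match s, t with
  | [::], [::] => true
  | x :: s', y :: t' => if eqb x y then eqbits s' t' else false
  | _, _ => false
  end.

Inductive orbit_info := Left_domain | Returned of nat | Ended of seq bool.

(* [Returned 0] stands for an orbit that could not be evaluated. *)
Fixpoint first_return (k : nat) (f : seq bool -> outcome) (q0 q : seq bool) :
    orbit_info :=
  if k is k'.+1 then
    match f q with
    | Violated => Left_domain
    | Reached q' =>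
        if eqbits q' q0 then Returned 1 else
        match first_return k' f q0 q' with
        | Returned t => Returned (if t is 0 then 0 else t.+1)
        | r => r
        end
    | Unknown => Returned 0
    end
  else Ended q.

(* Evaluates [d] iterations, where [d = e] if [exact] and [d] is otherwise of the
   form [e + 16 * m] with [0 < m]; short periods keep the evaluation cheap. *)
Definition eval_run (e : nat) (exact : bool) (f : seq bool -> outcome)
    (q : seq bool) : outcome :=
  match first_return (if exact then e else 16) f q q with
  | Left_domain => Violated
  | Ended q' => if exact then Reached q' else Unknown
  | Returned t =>
      if t is 0 then Unknown else
      if exact || (t %| 16) then eval_iter (e %% t) f q else Unknown
  end.

Variables (e : nat) (exact : bool).

Fixpoint eval_step (n : nat) (b : bool) (q : seq bool) : outcome :=
  if n is n'.+1 then
    if q is l :: q' then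
      then_do (if b then eval_run e exact (eval_step n' l) q' else eval_step n' l q')
        (fun q'' => Reached (~~ l :: q''))
    else Unknown
  else of_option (base_step bad b q).

(** Once a letter of level [n] is read, the first letter of the next run one level below is known
    too, so it is read as well, and so on downwards. *)
Fixpoint detect (n : nat) (b : bool) (q : seq bool) : bool :=
  match eval_step n b q with
  | Violated => true
  | Reached q' =>
      if n is n'.+1 then if q' is l :: q'' then detect n' l q'' else false else false
  | Unknown => false
  end.

Lemma detectE n b q :
  detect n b q =
  match eval_step n b q with
  | Violated => true
  | Reached q' =>
      if n is n'.+1 then if q' is l :: q'' then detect n' l q'' else false else false
  | Unknown => false
  end.
Proof. by case: n. Qed.

(* [b] and the first [n] bits of [q] are the initial letters of the iterated
   run-length encodings chosen so far. *)
Fixpoint search (depth n : nat) (b : bool) (q : seq bool) : bool :=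
  if detect n b q then true else
  if depth is depth'.+1 then
    if search depth' n.+1 false (b :: q) then search depth' n.+1 true (b :: q)
    else false
  else false.

Lemma eqbitsP s t : eqbits s t -> s = t.
Proof.
by elim: s t => [|x s IH] [|y t] //=; case: x y => [] [] //= /IH ->.
Qed.

Lemma eval_iter_describes k f g q : (forall q', describes (f q') (g q')) ->
  describes (eval_iter k f q) (oiter k g q).
Proof.
move=> fg; elim: k q => //= k IH q.
by have := fg q; case: (f q) => [|q'|] //= ->.
Qed.

Lemma first_return_describes k f g q0 q :
  (forall q', describes (f q') (g q')) ->
  match first_return k f q0 q with
  | Left_domain => oiter k g q = None
  | Returned t => 0 < t -> oiter t g q = Some q0
  | Ended q' => oiter k g q = Some q'
  end.
Proof.
move=> fg; elim: k q => [|k IH] q //.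
have := fg q; rewrite [first_return _ _ _ _]/=; case: (f q) => [|q'|] //= gq.
  by rewrite gq.
case: ifP => [/eqbitsP Eq|_]; first by rewrite /= gq Eq.
have := IH q'; case: (first_return k f q0 q') => [|[|t]|q''] //= IHq.
- by rewrite gq.
- by rewrite gq /= => _; apply: IHq.
- by rewrite gq.
Qed.

(** If [t] iterations return to [q], only [d] modulo [t] matters, and this is [e] modulo [t] when
    [m = 0] or [t] divides 16. *)
Lemma eval_run_describes m f g q :
    d = e + 16 * m -> (m == 0) = exact -> (forall q', describes (f q') (g q')) ->
  describes (eval_run e exact f q) (oiter d g q).
Proof.
move=> dE Em fg; rewrite /eval_run; set k := if exact then e else 16.
have le_kd : k <= d by rewrite /k -Em dE; case: (m) => [|m'] /=; lia.
move: (first_return k f q q) (@first_return_describes k f g q q fg) => [Ek|t|q' Ek].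
- by rewrite -(subnKC le_kd) oiterD Ek.
- case: t => // t /(_ isT) fix_q; case: ifP => // div_t.
  have -> : d = t.+1 * (d %/ t.+1) + e %% t.+1.
    rewrite [LHS](divn_eq d t.+1) mulnC; congr (_ + _); rewrite dE.
    case/orP: div_t; last by move=> div_t; rewrite -modnDmr (eqP (dvdn_mulr m div_t)) addn0.
    by rewrite -Em => /eqP ->; rewrite muln0 addn0.
  by rewrite oiterD (oiter_fixed _ fix_q); apply: eval_iter_describes.
- case: ifP => // ex; rewrite /k ex in Ek.
  by move: dE; move: Em; rewrite ex => /eqP -> ; rewrite muln0 addn0 => ->.
Qed.

Lemma eval_step_describes m n b q : d = e + 16 * m -> (m == 0) = exact ->
  describes (eval_step n b q) (level_step n b q).
Proof.
move=> dE Em; elim: n b q => [|n IH] b q; first by rewrite /=; case: base_step.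
case: q => [|l q] //=; case: b.
  have := eval_run_describes q dE Em (IH l).
  by case: eval_run => [|q'|] //= ->.
by have := IH l q; case: (eval_step n l q) => [|q'|] //= ->.
Qed.

End Automaton.

(** Even [d] below 16 are treated exactly, larger ones by their residue modulo 16. *)
Lemma detect_all_classes (bad : bool -> bool -> bool -> bool -> bool) (b : bool) d :
    ~~ odd d -> 0 < d ->
    all (fun e => search bad e false 9 0 b [:: false; false; false])
      [:: 0; 2; 4; 6; 8; 10; 12; 14] ->
    all (fun e => search bad e true 9 0 b [:: false; false; false])
      [:: 2; 4; 6; 8; 10; 12; 14] ->
  exists e exact m, [/\ d = e + 16 * m, (m == 0) = exact &
    search bad e exact 9 0 b [:: false; false; false]].
Proof.
move=> even_d d_gt0 /allP periodic /allP small.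
exists (d %% 16), (d %/ 16 == 0), (d %/ 16); split=> //; first by lia.
have [d_lt|d_ge] := ltnP d 16.
  rewrite divn_small // modn_small //; apply: small.
  by rewrite !inE; lia.
rewrite (_ : (d %/ 16 == 0) = false); last by lia.
by apply: periodic; rewrite !inE; lia.
Qed.

(** * Soundness of the search on smooth words *)

Section Reading.

Variables (d : nat) (v : iword) (bad : bool -> bool -> bool -> bool -> bool).
Hypotheses (d_gt1 : 1 < d) (even_d : ~~ odd d) (sm_v : smooth 1 d v) (v0 : v 0 = 1).

Let x := Delta v.
Let level n := iter n Delta x.

Hypothesis not_bad : forall i,
  bad (odd i) (odd (psum x i)) (odd (psum v (psum x i))) (x i == d) = false.

Fixpoint level_state (n i : nat) : seq bool :=
  if n is n'.+1 then
    let p := psum (level n) i in (level n' p == d) :: level_state n' p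
  else [:: odd i; odd (psum x i); odd (psum v (psum x i))].

Lemma smooth_level n : smooth 1 d (level n).
Proof. by elim: n => [|n IH]; apply: smooth_Delta. Qed.

Lemma level_stepE n i :
  level_step d bad n (level n i == d) (level_state n i) = Some (level_state n i.+1).
Proof.
elim: n i => [|n IH] i.
  rewrite /= not_bad; congr Some.
  have codv := smooth_coded (c := 1) isT d_gt1 sm_v (b := false) v0.
  (* Run [i] of [v] contributes [x i] copies of one letter; since [d] is even, the parity changes
     only when both numbers are 1. *)
  rewrite psumD (@psum_const _ (x i) (letter 1 d (odd i))); last first.
    by move=> j lt_j; rewrite /isuffix codv.
  rewrite !oddD oddM /letter.
  by case: (smooth_over (smooth_level 0) i) => /= ->; rewrite ?eqxx ?(ltn_eqF d_gt1);
    rewrite ?(negPf even_d) /=; case: (odd i); rewrite ?(negPf even_d) ?addbF ?addbT.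
have sm := smooth_level n; have sm' := smooth_level n.+1.
have pos' := smooth_gt0 (c := 1) isT d_gt1 sm'.
have cod : coded 1 d (level n 0 == d) (level n.+1) (level n).
  by apply: over_coded (smooth_over sm) pos'.
set p := psum (level n.+1) i.
have len : (if level n.+1 i == d then d else 1) = level n.+1 i.
  by case: (smooth_over sm' i) => ->; rewrite ?eqxx ?(ltn_eqF d_gt1).
rewrite [level_state _ _]/= -/p [LHS]/= len.
have same j : j < level n.+1 i -> level n (p + j) = level n p.
  by move=> lt_j; rewrite cod // (coded0 i pos' cod).
rewrite (oiter_path (s := level_state n)) => [|j lt_j]; last by rewrite -(same j lt_j).
rewrite /= -/p; congr (Some (_ :: _)).
rewrite (coded0 i.+1 pos' cod) (coded0 i pos' cod) oddS.
by case: (_ == d) (odd i) => [] []; rewrite /letter ?eqxx ?(ltn_eqF d_gt1).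
Qed.

Section Evaluation.

Variables (e m : nat) (exact : bool).
Hypotheses (dE : d = e + 16 * m) (mE : (m == 0) = exact).

Lemma detect_false n i :
  detect bad e exact n (level n i == d) (level_state n i) = false.
Proof.
elim: n i => [|n IH] i; rewrite detectE.
  have := eval_step_describes bad 0 (level 0 i == d) (level_state 0 i) dE mE.
  by rewrite level_stepE; case: eval_step.
have := eval_step_describes bad n.+1 (level n.+1 i == d) (level_state n.+1 i) dE mE.
by rewrite level_stepE; case: eval_step => [|q|] // [<-]; apply: IH.
Qed.

(** The branch following the actual initial letters of the iterated encodings never meets a
    violation. *)
Lemma search_false depth n :
  search bad e exact depth n (level n 0 == d) (level_state n 0) = false.
Proof.
elim: depth n => [|depth IH] n; rewrite /= detect_false //.
have := IH n.+1; rewrite [level_state _ _]/=.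
by case: (level n.+1 0 == d) => ->; rewrite ?if_same.
Qed.

Lemma search_start depth :
  search bad e exact depth 0 (x 0 == d) [:: false; false; false] = false.
Proof. exact: (search_false depth 0). Qed.

End Evaluation.

End Reading.

Lemma mixed_not_Lyndon c d w : 0 < c -> c < d -> odd d = ~~ odd c ->
  smooth c d w -> ~ infinite_Lyndon w.
Proof.
move=> c_gt0 lt_cd odd_dc sm /(Lyndon_Delta c_gt0 lt_cd sm)[_ Q].
have smu := smooth_Delta sm; have u0 := mixed_head c_gt0 lt_cd odd_dc smu Q.
have [c1 v0] := mixed_first_run c_gt0 lt_cd odd_dc smu Q u0; subst c.
set u := Delta w in smu Q u0 v0.
have smv := smooth_Delta smu; set v := Delta u in v0 smv.
have smx := smooth_Delta smv; set x := Delta v in smx.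
have even_d : ~~ odd d by rewrite odd_dc.
have x_gt0 := smooth_gt0 c_gt0 lt_cd smx.
have codv : coded 1 d false x v := smooth_coded c_gt0 lt_cd smv (b := false) v0.
have search_x bad := @search_start d v bad lt_cd even_d smv v0.
have v_run i j : ~~ odd i -> j < x i -> v (psum x i + j) = 1.
  by move=> /negPf even_i lt_j; rewrite codv // even_i.
have [x0|x0] := smooth_over smx 0.
(* Here [v] begins with 1 and [d], and [mixed_long_second] forbids a 1 of [v] at an odd position
   with odd partial sum. The first position of each run of ones is tested, and the second if the run
   has length [d]. *)
- pose bad (i a s b : bool) := ~~ i && (a && s || [&& ~~ a, ~~ s & b]).
  have [//|||e [exact [m [dE mE found]]]] := @detect_all_classes bad false d even_d.
  + by lia.
  + by vm_compute.
  + by vm_compute.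
  suff ok i : bad (odd i) (odd (psum x i)) (odd (psum v (psum x i))) (x i == d) = false.
    have x0d : (x 0 == d) = false by rewrite x0 ltn_eqF.
    by have := search_x bad ok e m exact dE mE 9; rewrite -/x x0d found.
  have v1 : v 1 = d by have := coded0 1 x_gt0 codv; rewrite /= add0n x0.
  have second a := @mixed_long_second 1 d c_gt0 lt_cd odd_dc u a smu Q u0 v0 v1.
  apply/negP => /andP[even_i /orP[/andP[odd_a odd_s]|/and3P[even_a even_s /eqP xi]]].
    by have := second _ odd_a odd_s; rewrite -/v -(addn0 (psum x i)) v_run //; lia.
  have va : v (psum x i + 0) = 1 by apply: v_run.
  have := second (psum x i + 1); rewrite -/v v_run ?xi // addn1 /= -/v.
  by rewrite addn0 in va; rewrite va addn1 /= even_a even_s; lia.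
(* Here [v] begins with [d] ones and a [d], and [mixed_long_first] forbids a run of [d] ones at an
   odd position with odd partial sum. *)
- pose bad (i a s b : bool) := [&& ~~ i, a, s & b].
  have [//|||e [exact [m [dE mE found]]]] := @detect_all_classes bad true d even_d.
  + by lia.
  + by vm_compute.
  + by vm_compute.
  suff ok i : bad (odd i) (odd (psum x i)) (odd (psum v (psum x i))) (x i == d) = false.
    have x0d : (x 0 == d) = true by rewrite x0 eqxx.
    by have := search_x bad ok e m exact dE mE 9; rewrite -/x x0d found.
  apply/negP => /and4P[even_i odd_a odd_s /eqP xi].
  apply: (@mixed_long_first 1 d c_gt0 lt_cd odd_dc u (psum x i) smu Q u0 erefl) => //.
  + by move=> j; rewrite -{1}x0 => lt_j; have := v_run 0 j isT lt_j.
  + by have := coded0 1 x_gt0 codv; rewrite /= add0n x0.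
  + by move=> j; rewrite -xi; apply: v_run.
Qed.

Theorem theorem34 (c d : nat) (c_gt0 : 0 < c) (lt_cd : c < d)
    (w : iword) (w_smooth : smooth c d w) :
  infinite_Lyndon w <->
  (~~ odd c /\ ~~ odd d /\ minimal_smooth c d w) \/
  (c = 1 /\ odd d /\
     (minimal_smooth 1 d w \/
      exists2 m, minimal_smooth 1 d m & w = Delta_inv 1 d 1 m)).
Proof.
have [odd_c|even_c] := boolP (odd c); have [odd_d|even_d] := boolP (odd d).
- rewrite (odd_LyndonP c_gt0 lt_cd odd_c odd_d w_smooth); split.
    by case=> c1 min_w; right; move: min_w; rewrite c1.
  by case=> [[]//|[c1 [_ min_w]]]; split=> //; rewrite c1.
- split=> [|[[]//|[_ []//]]].
  by move/(mixed_not_Lyndon c_gt0 lt_cd) => []//; rewrite odd_c (negPf even_d).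
- split=> [|[[_ []//]|[c1]]]; last by rewrite c1 in even_c.
  by move/(mixed_not_Lyndon c_gt0 lt_cd) => []//; rewrite odd_d even_c.
- rewrite (even_LyndonP c_gt0 lt_cd even_c even_d w_smooth); split.
    by move=> min_w; left.
  by case=> [[_ []//]|[_ []]].
Qed.
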